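(* Let $(T,d,\rho)$ be a rooted compact real tree that is not reduced to a point. Any compatible linear order on $(T,d,\rho)$ is of the form $\lhd_{\mathbf{O}}$, where $$\mathbf{O}=\{\lhd_\sigma\,,\ \sigma\in\mathrm{Br}(T)\cup\{\rho\}\}$$ is a certain choice of linear orders $\lhd_\sigma$ on the index sets $I_\sigma$, $\sigma\in\mathrm{Br}(T)\cup\{\rho\}$. Moreover, this representation of the compatible order is unique. (The index sets $I_\sigma$ and the order $\lhd_{\mathbf{O}}$ are defined in the context.)
   Context: A real tree is a metric space $(T,d)$ in which any two points $\sigma,\sigma'$ are joined by a path isometric to $[0,d(\sigma,\sigma')]$, with image denoted $[\![\sigma,\sigma']\!]$, and such that every continuous injective $q:[0,1]\to T$ has image $[\![q(0),q(1)]\!]$. It is rooted if a point $\rho\in T$ is distinguished. The point $\sigma\wedge\sigma'$ is defined by $[\![\rho,\sigma\wedge\sigma']\!]=[\![\rho,\sigma]\!]\cap[\![\rho,\sigma']\!]$. $\mathrm{Br}(T)$ is the set of $\sigma\in T\setminus\{\rho\}$ such that $T\setminus\{\sigma\}$ has at least $3$ connected components. A linear order $\leq$ on $T$ is compatible if it satisfies: - (Or1): if $\sigma_1\in[\![\rho,\sigma_2]\!]$ then $\sigma_1\leq\sigma_2$; - (Or2): if $\sigma_1\leq\sigma_2\leq\sigma_3$, then $\gamma\in[\![\rho,\sigma_2]\!]$, where $\gamma$ is defined by $[\![\rho,\gamma]\!]=[\![\rho,\sigma_1]\!]\cap([\![\rho,\sigma_2]\!]\cup[\![\rho,\sigma_3]\!])$.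 For $\sigma\in T$, let $\mathcal{C}_\sigma$ be the (at most countable) set of connected components of $T\setminus\{\sigma\}$ that do not contain $\rho$. Fix once and for all, for each $\sigma\in T$, an index set $I_\sigma$ equal to $\emptyset$, $\{1,\dots,n\}$ for some $n\ge1$, or $\{1,2,\dots\}$, and a bijection $k\mapsto C_\sigma(k)$ from $I_\sigma$ onto $\mathcal{C}_\sigma$. Given $\mathbf{O}=\{\lhd_\sigma,\ \sigma\in\mathrm{Br}(T)\cup\{\rho\}\}$, where $\lhd_\sigma$ is a linear order on $I_\sigma$, the (reflexive) relation $\lhd_{\mathbf{O}}$ on $T$ is defined for distinct $\sigma,\sigma'$ by: - (Def1) if $\sigma\wedge\sigma'\in\{\sigma,\sigma'\}$, then $\sigma\lhd_{\mathbf{O}}\sigma'$ if $\sigma\in[\![\rho,\sigma']\!]$, and $\sigma'\lhd_{\mathbf{O}}\sigma$ if $\sigma'\in[\![\rho,\sigma]\!]$; - (Def2) if $\sigma\wedge\sigma'\notin\{\sigma,\sigma'\}$, then $\sigma\wedge\sigma'\in\mathrm{Br}(T)\cup\{\rho\}$ and there are distinct $k,k'\in I_{\sigma\wedge\sigma'}$ with $\sigma\in C_{\sigma\wedge\sigma'}(k)$ and $\sigma'\in C_{\sigma\wedge\sigma'}(k')$; then $\sigma\lhd_{\mathbf{O}}\sigma'$ if $k\lhd_{\sigma\wedge\sigma'}k'$, and $\sigma'\lhd_{\mathbf{O}}\sigma$ if $k'\lhd_{\sigma\wedge\sigma'}k$. *)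

(* Defs.v *)
From mathcomp Require Import all_boot all_order all_algebra.
From mathcomp Require Import all_classical all_reals all_analysis.
Set Implicit Arguments.
Unset Strict Implicit.
Unset Printing Implicit Defensive.
Import Order.TTheory GRing.Theory Num.Theory.
Import numFieldNormedType.Exports.
Local Open Scope classical_set_scope.
Local Open Scope ring_scope.

Definition linear_order_on (X : Type) (A : set X) (le : X -> X -> Prop) : Prop :=
  [/\ forall x, A x -> le x x,
      forall x y, A x -> A y -> le x y -> le y x -> x = y,
      forall x y z, A x -> A y -> A z -> le x y -> le y z -> le x z
    & total_on A le].

Section RealTree.
Context {R : realType} {T : metricType R}.
Implicit Types (x y z s g rho : T) (le : T -> T -> Prop).

Definition geodesic x y (f : R -> T) : Prop :=
  [/\ f 0 = x, f (mdist x y) = y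
    & {in `[0, mdist x y] &, forall t u, mdist (f t) (f u) = `|t - u|}].

(* The union of all geodesics from x to y; in a real tree any two geodesics
   with the same endpoints have the same image, so this is that image. *)
Definition segment x y : set T :=
  [set z | exists f : R -> T,
     geodesic x y f /\ (f @` `[0, mdist x y]%classic) z].

(* The real tree is the whole type T, with the distance mdist. *)
Definition real_tree : Prop :=
  (forall x y, exists f : R -> T, geodesic x y f) /\
  (forall q : R -> T,
     {within `[0, 1]%classic, continuous q} ->
     {in `[0, 1] &, injective q} ->
     q @` `[0, 1]%classic = segment (q 0) (q 1)).

(* The point g such that segment rho g = A; in a real tree it is unique when it
   exists, and it exists for every A to which [apex] is applied below. *)
Definition apex rho (A : set T) : T := xget rho [set g | segment rho g = A].

Definition meet rho x y : T := apex rho (segment rho x `&` segment rho y).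

Definition components (A : set T) : set (set T) := connected_component A @` A.

Definition branch_points rho : set T :=
  [set s | s <> rho /\ (`I_3 #<= components (~` [set s]))%card].

Definition branch_or_root rho : set T := branch_points rho `|` [set rho].

Definition compatible_order rho le : Prop :=
  [/\ linear_order_on [set: T] le,
      forall x1 x2, segment rho x2 x1 -> le x1 x2
    & forall x1 x2 x3, le x1 x2 -> le x2 x3 ->
        segment rho x2
          (apex rho (segment rho x1 `&` (segment rho x2 `|` segment rho x3)))].

Definition upper_components rho s : set (set T) :=
  [set C | components (~` [set s]) C /\ ~ C rho].

(* The case n = 0 of the first alternative is the empty index set. *)
Definition index_range (I : set nat) : Prop :=
  (exists n : nat, I = [set k | (1 <= k <= n)%N]) \/ I = [set k | (1 <= k)%N].

Definition component_indexing rho (I : T -> set nat) (C : T -> nat -> set T)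
    : Prop :=
  forall s, index_range (I s) /\ set_bij (I s) (upper_components rho s) (C s).

(* [O s] is the order on the index set [I s]; its values outside [I s], or for s
   not in [branch_or_root rho], are irrelevant. *)
Definition order_family rho (I : T -> set nat) (O : T -> nat -> nat -> Prop)
    : Prop :=
  forall s, branch_or_root rho s -> linear_order_on (I s) (O s).

Inductive tree_order rho (I : T -> set nat) (C : T -> nat -> set T)
    (O : T -> nat -> nat -> Prop) x y : Prop :=
| tree_order_refl of x = y
| tree_order_def1 of x <> y & [set x; y] (meet rho x y) & segment rho y x
| tree_order_def2 k k' of ~ [set x; y] (meet rho x y)
    & branch_or_root rho (meet rho x y)
    & I (meet rho x y) k & I (meet rho x y) k' & k <> k'
    & C (meet rho x y) k x & C (meet rho x y) k' y
    & O (meet rho x y) k k'.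

Definition represents rho (I : T -> set nat) (C : T -> nat -> set T)
    (le : T -> T -> Prop) (O : T -> nat -> nat -> Prop) : Prop :=
  order_family rho I O /\ (forall x y, le x y <-> tree_order rho I C O x y).

End RealTree.

(* Main.v *)
Require Import Defs.
From mathcomp Require Import all_boot all_order all_algebra.
From mathcomp Require Import all_classical all_reals all_analysis.
From mathcomp Require Import lra.
Import Order.TTheory GRing.Theory Num.Theory.
Import numFieldNormedType.Exports.
Local Open Scope classical_set_scope.

(** A compatible order is pinned down by how it compares the components of
    T minus a point s that do not contain the root: each of them is convex with
    respect to the others.  Suppose that x and x' lie in one such component,
    y in another one, and x <= y <= x'.  All three points are above s, with
    meet rho x y = s, whereas the branch point g of x and x' lies strictly
    above s; hence [rho, x] meets [rho, y] in [rho, s] and [rho, x'] in the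
    larger segment [rho, g].  The apex in the second axiom of compatible orders
    is therefore g, and the axiom would force g to lie on [rho, y], so on
    [rho, s], which is absurd ([component_convex]).  By totality, if one point
    of a component is below one point of another component, then every point
    of the first is below every point of the second ([component_le]).

    Comparing arbitrary representatives of the components thus gives a linear
    order on each index set.  It represents the given order: two points with
    neither on the root segment of the other are separated by their meet, which
    is the root or a branch point ([meet_branch]), and the first axiom settles
    the remaining pairs.  Conversely any representation must compare two
    indices at s as the order compares any two points of the corresponding
    components, since the meet of these points is s ([represents_orderP]);
    this is uniqueness.

    The geometry behind this comes from two facts.  Segments are metric
    intervals ([segmentP]), on which a point is determined by its distance to
    one end; and the meet of x and y with respect to any base point lies on
    [x, y] ([meet_segment]), so every segment is covered by the other two sides
    of a triangle ([segment_triangle]).  The latter implies that x and y are in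
    the same component of T minus s exactly when s is not on [x, y]
    ([component_segmentP]). *)

(** * Segments of a real tree *)

Section RealTrees.
Local Open Scope ring_scope.
Set Implicit Arguments.
Unset Strict Implicit.
Context {R : realType} {T : metricType R}.
Implicit Types (x y z w m p q : T) (f g h : R -> T).

Lemma lipschitz_continuous_within (k : R) (A : set R) f :
  (forall t u, A t -> A u -> mdist (f t) (f u) <= k * `|t - u|) ->
  {within A, continuous f}.
Proof.
move=> flip; apply/subspace_continuousP => t At.
apply/(@metricType_numDomainType.cvgrPdist_lt R T) => e e0.
have k0 : 0 < `|k| + 1 by rewrite ltr_wpDl.
near=> u.
have Au : A u by near: u; exact: withinT.
rewrite (le_lt_trans (flip _ _ At Au))//.
have tu : `|t - u| < e / (`|k| + 1).
  by near: u; apply: cvg_within; apply: nbhsx_ballx; exact: divr_gt0.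
rewrite (@le_lt_trans _ _ ((`|k| + 1) * `|t - u|))//.
  by rewrite ler_wpM2r// ler_wpDr// ler_norm.
by rewrite mulrC -ltr_pdivlMr.
Unshelve. all: by end_near. Qed.

(** The uniqueness axiom of real trees is about paths parametrised by [0, 1];
    this rescaled form suits paths parametrised by arc length. *)
Lemma path_image (L : R) h : real_tree (T := T) -> 0 < L ->
  (forall t u, 0 <= t <= L -> 0 <= u <= L -> mdist (h t) (h u) <= `|t - u|) ->
  (forall t u, 0 <= t <= L -> 0 <= u <= L -> h t = h u -> t = u) ->
  h @` `[0, L] = segment (h 0) (h L).
Proof.
move=> [_ tree] L0 hlip hinj.
have in01 t : 0 <= t <= 1 -> 0 <= L * t <= L.
  move=> /andP[t0 t1]; rewrite mulr_ge0 ?(ltW L0)//=.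
  by rewrite ger_pMr.
have := tree (fun t => h (L * t)); rewrite mulr0 mulr1 => <-.
- apply/seteqP; split=> z [t /=]; rewrite in_itv/=.
    move=> /andP[t0 tL] <-; exists (t / L); last first.
      by rewrite mulrC divfK// gt_eqF.
    by rewrite /= in_itv/= divr_ge0 ?(ltW L0)//= ler_pdivrMr// mul1r.
  by move=> /in01 tL <-; exists (L * t) => //=; rewrite in_itv.
- apply: (@lipschitz_continuous_within L) => t u /=; rewrite !in_itv/=.
  move=> /in01 tL /in01 uL; rewrite (le_trans (hlip _ _ tL uL))//.
  by rewrite -mulrBr normrM gtr0_norm.
- move=> t u; rewrite !in_itv/= => /in01 tL /in01 uL /(hinj _ _ tL uL).
  by apply: mulfI; rewrite gt_eqF.
Qed.

(** A geodesic between distinct points is an injective path, so it already fills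
    the union of all geodesics with the same endpoints. *)
Lemma geodesic_image x y f : real_tree (T := T) -> geodesic x y f ->
  segment x y = f @` `[0, mdist x y].
Proof.
move=> tree [fx fy fiso].
have := mdist_ge0 x y; rewrite le_eqVlt => /predU1P[/esym xy0|xy0].
  have single g : g 0 = x -> g @` `[0, mdist x y] = [set x].
    move=> gx; rewrite xy0 set_itv1 image_set1 gx//.
  rewrite single//; apply/seteqP; split=> [z [g [[gx _ _]]]|z ->].
    by rewrite single.
  exists f; split=> //; rewrite single//.
have fisoE t u : 0 <= t <= mdist x y -> 0 <= u <= mdist x y ->
    mdist (f t) (f u) = `|t - u|.
  by move=> tL uL; apply: fiso; rewrite in_itv.
rewrite path_image// ?fx ?fy// => t u tL uL; first by rewrite fisoE.
move=> ftu; have := fisoE _ _ tL uL.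
by rewrite ftu mdistxx => /esym/eqP; rewrite normr_eq0 subr_eq0 => /eqP.
Qed.

Lemma geodesic_dist x y f t : geodesic x y f -> 0 <= t <= mdist x y ->
  mdist x (f t) = t /\ mdist (f t) y = mdist x y - t.
Proof.
move=> [fx fy fiso] /andP[t0 tL]; split.
  rewrite -[in LHS]fx fiso ?in_itv/= ?lexx ?t0 ?mdist_ge0//.
  by rewrite sub0r normrN ger0_norm.
rewrite -[in LHS]fy fiso ?in_itv/= ?lexx ?t0 ?mdist_ge0//.
by rewrite ler0_norm ?subr_le0// opprB.
Qed.

Hypothesis tree : real_tree (T := T).

(** Equality in the triangle inequality at z makes the concatenation of a
    geodesic from x to z and one from z to y a geodesic.  Betweenness thus
    becomes linear arithmetic on distances. *)
Lemma segmentP x y z : segment x y z <-> mdist x z + mdist z y = mdist x y.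
Proof.
split=> [[f [fgeo [t /=]]]|xzy].
  rewrite in_itv/= => /(geodesic_dist fgeo)[xt ty] <-; rewrite xt ty; lra.
have [[f fgeo] [g ggeo]] := (tree.1 x z, tree.1 z y).
have [[fx fz fiso] [gz gy giso]] := (fgeo, ggeo).
pose h t := if t <= mdist x z then f t else g (t - mdist x z).
have xz0 := mdist_ge0 x z; have zy0 := mdist_ge0 z y.
exists h; split; last first.
  by exists (mdist x z); rewrite /= ?in_itv/= /h ?lexx//; lra.
(* d(x, y) <= d(x, f t) + d(f t, g (u - d(x, z))) + d(g (u - d(x, z)), y) gives
   the lower bound, the triangle through z the upper one. *)
have cross t u : 0 <= t <= mdist x z -> mdist x z < u <= mdist x y ->
    mdist (f t) (g (u - mdist x z)) = u - t.
  move=> tL uL.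
  have [] := geodesic_dist fgeo tL.
  have [|] := @geodesic_dist _ _ _ (u - mdist x z) ggeo; first by lra.
  move: (metric_triangle (f t) z (g (u - mdist x z))).
  move: (metric_triangle x (f t) y).
  move: (metric_triangle (f t) (g (u - mdist x z)) y).
  lra.
have hiso : forall t u, 0 <= t -> u <= mdist x y -> t <= u ->
    mdist (h t) (h u) = u - t.
  move=> t u t0 uL tu; rewrite /h.
  have [tz|tz] := leP t (mdist x z); have [uz|uz] := leP u (mdist x z).
  - by rewrite fiso ?in_itv/= ?ler0_norm//; lra.
  - by apply: cross; lra.
  - lra.
  - by rewrite giso ?in_itv/= ?ler0_norm//; lra.
split.
- by rewrite /h xz0.
- rewrite /h; have [xyz|_] := leP; last by rewrite -xzy addrC addKr.
  have zy : z = y by apply: mdist_positivity; lra.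
  by rewrite -[X in f (mdist x X)]zy fz.
- move=> t u; rewrite !in_itv/= => /andP[t0 tL] /andP[u0 uL].
  have [tu|/ltW ut] := leP t u.
    by rewrite hiso// ler0_norm; lra.
  by rewrite metric_sym hiso// ger0_norm; lra.
Qed.

Lemma segmentC x y z : segment x y z -> segment y x z.
Proof.
move=> /segmentP xzy; apply/segmentP.
by rewrite (metric_sym y z) (metric_sym z x) (metric_sym y x) addrC.
Qed.

Lemma segment_left x y : segment x y x.
Proof. by apply/segmentP; rewrite mdistxx add0r. Qed.

Lemma segment_right x y : segment x y y.
Proof. by apply/segmentP; rewrite mdistxx addr0. Qed.

Lemma segmentxx x y : segment x x y -> y = x.
Proof.
move=> /segmentP; rewrite mdistxx => xyx; apply: mdist_positivity.
move: (mdist_ge0 x y) (mdist_ge0 y x); lra.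
Qed.

Lemma segment_dist_inj x y z w :
  segment x y z -> segment x y w -> mdist x z = mdist x w -> z = w.
Proof.
have [f fgeo] := tree.1 x y; rewrite (geodesic_image tree fgeo).
move=> [t /=]; rewrite in_itv/= => /(geodesic_dist fgeo)[xt _] <-.
move=> [u /=]; rewrite in_itv/= => /(geodesic_dist fgeo)[xu _] <-.
by rewrite xt xu => ->.
Qed.

Lemma segment_at_dist x y (t : R) : 0 <= t <= mdist x y ->
  exists2 z, segment x y z & mdist x z = t.
Proof.
have [f fgeo] := tree.1 x y => tL.
exists (f t); last exact: (geodesic_dist fgeo tL).1.
by rewrite (geodesic_image tree fgeo); exists t; rewrite //= in_itv.
Qed.

Lemma segment_sub x y z w : segment x y z -> segment x z w -> segment x y w.
Proof.
move=> /segmentP xzy /segmentP xwz; apply/segmentP.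
move: (metric_triangle w z y) (metric_triangle x w y); lra.
Qed.

Lemma segment_inner x y z w : segment x y z -> segment x z w -> segment w y z.
Proof.
move=> /segmentP xzy /segmentP xwz; apply/segmentP.
move: (metric_triangle w z y) (metric_triangle x w y); lra.
Qed.

Lemma segment_anti x y z : segment x y z -> segment x z y -> y = z.
Proof.
move=> /segmentP xzy /segmentP xyz; apply: mdist_positivity.
move: (mdist_ge0 y z); rewrite (metric_sym z y) in xzy; lra.
Qed.

Lemma segment_le_dist x y z w : segment x y z -> segment x y w ->
  mdist x z <= mdist x w -> segment x w z.
Proof.
move=> xyz xyw zw; have [|z' xwz' z'z] := @segment_at_dist x w (mdist x z).
  by rewrite mdist_ge0.
by rewrite (segment_dist_inj xyz (segment_sub xyw xwz') (esym z'z)).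
Qed.

Lemma segment_total x y z w : segment x y z -> segment x y w ->
  segment x w z \/ segment x z w.
Proof.
move=> xyz xyw; have [|/ltW] := leP (mdist x z) (mdist x w).
  by left; exact: segment_le_dist xyw _.
by right; exact: segment_le_dist xyz _.
Qed.

(** The common part of two segments issued from r contains the segment from r to
    each of its points, so it is enough to find a common point at the largest
    distance from r.  That distance is first obtained as a supremum; the points
    p and q at that distance on the two segments are both limits of common
    points, hence equal. *)
Lemma segment_capE r x y :
  exists m, segment r m = segment r x `&` segment r y.
Proof.
pose S := mdist r @` (segment r x `&` segment r y).
have Sub z : (segment r x `&` segment r y) z ->
    mdist r z <= mdist r x /\ mdist r z <= mdist r y.
  move=> [/segmentP + /segmentP].
  move: (mdist_ge0 z x) (mdist_ge0 z y); lra.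
have supS : has_sup S.
  split; first by exists (mdist r r), r => //; split; exact: segment_left.
  by exists (mdist r x) => _ [z /Sub[zx _] <-].
have S0 : 0 <= sup S.
  apply: le_trans (mdist_ge0 r r) _; apply: sup_upper_bound => //.
  by exists r => //; split; exact: segment_left.
have Sx : sup S <= mdist r x by apply: ge_sup supS.1 _ => _ [z /Sub[zx _] <-].
have Sy : sup S <= mdist r y by apply: ge_sup supS.1 _ => _ [z /Sub[_ zy] <-].
have [|p rxp pS] := @segment_at_dist r x (sup S); first by rewrite S0.
have [|q ryq qS] := @segment_at_dist r y (sup S); first by rewrite S0.
have le_sup z : (segment r x `&` segment r y) z -> mdist r z <= sup S.
  by move=> Sz; apply: sup_upper_bound => //; exists z.
have pq : p = q.
  apply: mdist_positivity; apply/eqP; rewrite eq_le mdist_ge0 andbT.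
  apply/ler_addgt0Pl => e e0; rewrite addr0.
  have [|_ [z Sz <-] ez] := @sup_adherent _ S (e / 2) _ supS; first lra.
  have [zx zy] := Sz.
  have /segmentP rpz : segment r p z.
    by apply: segment_le_dist rxp _ => //; rewrite pS le_sup.
  have /segmentP rqz : segment r q z.
    by apply: segment_le_dist ryq _ => //; rewrite qS le_sup.
  have := metric_triangle p z q; rewrite (metric_sym p z).
  by move: rpz rqz; rewrite pS qS; lra.
exists p; apply/seteqP; split=> [z rpz|z zxy].
  split; first exact: segment_sub rxp rpz.
  by rewrite pq in rpz; exact: segment_sub ryq rpz.
by apply: segment_le_dist rxp _; rewrite ?pS ?le_sup//; case: zxy.
Qed.

Lemma segment_right_inj r m m' : segment r m = segment r m' -> m = m'.
Proof.
move=> mm'; apply: (@segment_anti r).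
  by rewrite mm'; exact: segment_right.
by rewrite -mm'; exact: segment_right.
Qed.

Lemma apexE r m : apex r (segment r m) = m.
Proof.
apply: (@segment_right_inj r).
by apply: (@xgetPex _ r [set g | segment r g = segment r m]); exists m.
Qed.

Lemma meetP r x y : segment r (meet r x y) = segment r x `&` segment r y.
Proof. by have [m mE] := segment_capE r x y; rewrite /meet -mE apexE. Qed.

Lemma meet_mem r x y :
  segment r x (meet r x y) /\ segment r y (meet r x y).
Proof.
by have := segment_right r (meet r x y); rewrite [X in X _]meetP.
Qed.

(** The segments [x, m] and [m, y] share only m: a common point w is on [r, x]
    and [r, y], hence on [r, m], while m is on [r, w].  Their concatenation is
    then an injective path from x to y, and its image has to be [x, y]. *)
Lemma meet_segment r x y : segment x y (meet r x y).
Proof.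
set m := meet r x y.
have [rxm rym] : segment r x m /\ segment r y m := meet_mem r x y.
have only_m w : segment x m w -> segment m y w -> w = m.
  move=> xmw myw.
  have rxw : segment r x w.
    exact/segmentC/(@segment_sub _ _ m _ (segmentC rxm)).
  have ryw : segment r y w.
    apply/segmentC/(@segment_sub _ _ m _ (segmentC rym)).
    exact: segmentC.
  have rmw : segment r m w by rewrite meetP.
  apply/esym/(@segment_anti r) => //.
  apply/segmentC/(@segment_inner x) => //; exact: segmentC.
have [[f fgeo] [g ggeo]] := (tree.1 x m, tree.1 m y).
have [[fx fm fiso] [gm gy giso]] := (fgeo, ggeo).
have xm0 := mdist_ge0 x m; have my0 := mdist_ge0 m y.
pose a := mdist x m; pose L := a + mdist m y.
pose h t := if t <= a then f t else g (t - a).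
have := addr_ge0 xm0 my0; rewrite le_eqVlt => /predU1P[L0|L0].
  have -> : x = m by apply: mdist_positivity; lra.
  exact: segment_left.
have hx : h 0 = x by rewrite /h /a xm0.
have hy : h L = y.
  rewrite /h; have [La|_] := leP; last by rewrite /L addrAC subrr add0r.
  have my : mdist m y = 0 by move: La; rewrite /L; lra.
  by rewrite /L my addr0 /a fm; apply: mdist_positivity.
rewrite -{1}hx -hy -path_image//.
- exists a; rewrite /= ?in_itv/= /h ?lexx//; rewrite /L /a; lra.
- move=> t u; wlog tu : t u / t <= u => [hw tL uL|].
    have [/hw|/ltW /hw] := leP t u; first exact.
    by rewrite metric_sym distrC; exact.
  move=> tL uL; rewrite /h.
  have [ta|ta] := leP t a; have [ua|ua] := leP u a.
  + by rewrite fiso ?in_itv/= -/a; lra.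
  + have [|_] := @geodesic_dist _ _ _ t fgeo; first by rewrite -/a; lra.
    have [|+ _] := @geodesic_dist _ _ _ (u - a) ggeo.
      by move: uL; rewrite /L; lra.
    move: (metric_triangle (f t) m (g (u - a))).
    rewrite ler0_norm -/a; lra.
  + lra.
  + have -> : t - u = (t - a) - (u - a) by lra.
    by rewrite giso ?in_itv//=; move: tL uL; rewrite /L; lra.
- move=> t u; wlog tu : t u / t <= u => [hw tL uL htu|].
    have [tu|/ltW ut] := leP t u; first exact: hw.
    by apply/esym/hw.
  move=> tL uL; rewrite /h.
  have [ta|ta] := leP t a; have [ua|ua] := leP u a.
  + have [|ft _] := @geodesic_dist _ _ _ t fgeo; first by rewrite -/a; lra.
    have [|fu _] := @geodesic_dist _ _ _ u fgeo; first by rewrite -/a; lra.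
    by move=> ftu; rewrite -ft ftu fu.
  + have uL' : 0 <= u - a <= mdist m y by move: uL; rewrite /L; lra.
    have [gu _] := @geodesic_dist _ _ _ (u - a) ggeo uL'.
    move=> ftu; suff gum : g (u - a) = m by move: gu; rewrite gum mdistxx; lra.
    apply: only_m; last first.
      by rewrite (geodesic_image tree ggeo); exists (u - a).
    rewrite -ftu (geodesic_image tree fgeo); exists t => //=.
    by rewrite in_itv/= -/a; lra.
  + lra.
  + have [|gt _] := @geodesic_dist _ _ _ (t - a) ggeo.
      by move: tL; rewrite /L; lra.
    have [|gu _] := @geodesic_dist _ _ _ (u - a) ggeo.
      by move: uL; rewrite /L; lra.
    by move=> gtu; move: gt; rewrite gtu gu; lra.
Qed.

(** Both halves of [x, z], cut at the meet of x and z seen from y, lie on the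
    segments issued from y. *)
Lemma segment_triangle x y z : segment x z `<=` segment x y `|` segment y z.
Proof.
move=> w xzw; have xzm := meet_segment y x z; set m := meet y x z in xzm.
have [yxm yzm] : segment y x m /\ segment y z m := meet_mem y x z.
have [xmw|xwm] := segment_total xzw xzm.
  by left; apply: segment_sub xmw; exact: segmentC.
right; apply/segmentC/(@segment_sub _ _ m); first exact: segmentC.
apply/segmentC; exact: segment_inner xzw xwm.
Qed.

End RealTrees.

(** * Components of the complement of a point *)

Section Components.
Local Open Scope ring_scope.
Set Implicit Arguments.
Unset Strict Implicit.
Context {R : realType} {T : metricType R}.
Implicit Types (x y z w m s : T) (f : R -> T).
Hypothesis tree : real_tree (T := T).

Lemma connected_segment x y : connected (segment x y).
Proof.
have [f fgeo] := tree.1 x y; rewrite (geodesic_image tree fgeo).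
apply: connected_continuous_connected; first exact: segment_connected.
apply: (@lipschitz_continuous_within _ _ 1) => t u /= tL uL.
by case: fgeo => _ _ ->; rewrite ?mul1r.
Qed.

Lemma near_not_between s z w : mdist z w < mdist z s -> ~ segment z w s.
Proof. by move=> zws /(segmentP tree); move: (mdist_ge0 s w); lra. Qed.

(** The set of points w with s on [x, w], and the set of those without, are both
    open in the complement of s: moving w by less than its distance to s cannot
    change the side, by the triangle property of segments.  If x or y is s,
    both sides of the equivalence are false. *)
Lemma component_segmentP s x y :
  connected_component (~` [set s]) x y <-> ~ segment x y s.
Proof.
split=> [xy|xsy]; last first.
  apply: (@connected_component_max _ _ (segment x y)).
  - exact: segment_left.
  - by move=> z xzy /= zs; apply: xsy; rewrite -zs.
  - exact: connected_segment.
  - exact: segment_right.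
set K := connected_component _ x in xy.
have Ks z : K z -> z <> s by move=> /connected_component_sub.
have open_side (P : T -> Prop) :
    (forall z w, ~ segment z w s -> P z -> P w) ->
    open [set z | z <> s /\ P z].
  move=> Pside; rewrite openE => z [zs Pz]; apply/nbhs_ballP.
  exists (mdist z s) => /=; first by rewrite mdist_gt0; apply/eqP.
  move=> w; rewrite ballEmdist /= => zw; split.
    by move=> ws; move: zw; rewrite ws ltxx.
  exact: Pside (near_not_between zw) Pz.
suff KE : [set z | K z /\ ~ segment x z s] = K by move: xy; rewrite -KE => -[].
apply: (@component_connected _ (~` [set s]) x).
- exists x; split.
    by have [B [Bx Bs Bc] By] := xy; exists B.
  move=> /(segmentxx tree) xs.
  have [B [Bx Bs _] _] := xy; exact: (Bs x Bx).
- exists [set z | z <> s /\ ~ segment x z s].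
    apply: open_side => z w zw xz xw.
    by have [|] := @segment_triangle _ _ tree x z w s xw.
  by apply/seteqP; split=> z /= [Kz]; [split=> //; split=> //; exact: Ks|case].
- exists (~` [set z | z <> s /\ segment x z s]).
    apply: open_closedC; apply: open_side => z w zw xz.
    by have [//|/(segmentC tree)] := @segment_triangle _ _ tree x w z s xz.
  apply/seteqP; split=> z /= [Kz xz]; split=> //; first by case.
  by move=> xzs; apply: xz; split=> //; exact: Ks.
Qed.

Lemma three_components s x y z :
  segment x y s -> segment x z s -> segment y z s ->
  x <> s -> y <> s -> z <> s ->
  (`I_3 #<= components (~` [set s]))%card.
Proof.
move=> xys xzs yzs xs ys zs.
pose f n := connected_component (~` [set s]) (nth x [:: x; y; z] n).
have sep u v : v <> s -> segment u v s ->
    connected_component (~` [set s]) u <> connected_component (~` [set s]) v.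
  move=> vs uvs uv; have := @connected_component_refl _ (~` [set s]) v vs.
  by rewrite -uv => /component_segmentP.
have finj : set_inj `I_3 f.
  move=> i j; rewrite !inE /f.
  move: i j => [|[|[|//]]] [|[|[|//]]] _ _ //= fij; exfalso.
  - exact: sep xys fij.
  - exact: sep xzs fij.
  - exact: sep xys (esym fij).
  - exact: sep yzs fij.
  - exact: sep xzs (esym fij).
  - exact: sep yzs (esym fij).
have /card_eqPle[_ If] := inj_card_eq finj.
apply: card_le_trans If _; apply: subset_card_le => _ [[|[|[|//]]] _ <-].
- by exists x.
- by exists y.
- by exists z.
Qed.

End Components.

(** * Compatible orders *)

Section CompatibleOrders.
Set Implicit Arguments.
Unset Strict Implicit.
Context {R : realType} {T : metricType R}.
Variables (rho : T) (I : T -> set nat) (C : T -> nat -> set T).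
Implicit Types (x y z s m : T) (k : nat).
Hypotheses (tree : real_tree (T := T)) (indexIC : component_indexing rho I C).

Lemma index_mem s k x : I s k -> C s k x ->
  C s k = connected_component (~` [set s]) x /\ segment rho x s.
Proof.
move=> Ik; have [_ [Cup _ _]] := indexIC s; have [[z _ <-] Czrho] := Cup k Ik.
move=> Czx; have Cx := same_connected_component Czx.
split=> //; apply: (segmentC tree); apply: contrapT.
move=> /(component_segmentP tree).
by rewrite -Cx.
Qed.

Lemma index_mem_neq s k x : I s k -> C s k x -> x <> s.
Proof.
move=> Ik Cx; have [CE _] := index_mem Ik Cx.
by move: Cx; rewrite CE => /connected_component_sub.
Qed.

Lemma index_exists s x :
  x <> s -> segment rho x s -> exists2 k, I s k & C s k x.
Proof.
move=> xs rxs; have [_ [_ _ Csurj]] := indexIC s.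
have [|k Ik CE] := Csurj (connected_component (~` [set s]) x); last first.
  by exists k => //; rewrite CE; apply: connected_component_refl.
split; first by exists x.
by move=> /(component_segmentP tree); apply; exact: segmentC.
Qed.

Lemma index_segmentP s k k' x y : I s k -> I s k' -> C s k x -> C s k' y ->
  k <> k' <-> segment x y s.
Proof.
move=> Ik Ik' Cx Cy; have [CxE _] := index_mem Ik Cx.
have [CyE _] := index_mem Ik' Cy; split=> [kk'|xys kk'].
  apply: contrapT => /(component_segmentP tree) xy; apply: kk'.
  have [_ [_ Cinj _]] := indexIC s; apply: Cinj; rewrite ?inE//.
  by rewrite CxE CyE; exact: same_connected_component.
by move: Cy; rewrite -kk' CxE => /(component_segmentP tree).
Qed.

Lemma index_nonempty s k : I s k -> C s k !=set0.
Proof.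
move=> Ik; have [_ [Cup _ _]] := indexIC s; have [[z zs <-] _] := Cup k Ik.
by exists z; apply: connected_component_refl.
Qed.

(** By the triangle property, s is on [x, m] or [m, y] with m the meet; being
    also on [rho, m], it can only be m. *)
Lemma meet_eq s x y :
  segment rho x s -> segment rho y s -> segment x y s -> meet rho x y = s.
Proof.
move=> rxs rys xys; set m := meet rho x y.
have [rxm rym] := meet_mem tree rho x y.
have rms : segment rho m s by rewrite (meetP tree).
have onside z : segment rho z m -> segment z m s -> m = s.
  move=> rzm zms; apply: (segment_anti tree zms).
  by apply/segmentC => //; exact: (segment_inner tree rzm rms).
have [xms|mys] := @segment_triangle _ _ tree x m y s xys.
  exact: onside xms.
by apply: onside rym _; exact: segmentC.
Qed.

Lemma index_meet s k k' x y : I s k -> I s k' -> k <> k' ->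
  C s k x -> C s k' y -> meet rho x y = s.
Proof.
move=> Ik Ik' kk' Cx Cy; have [_ rxs] := index_mem Ik Cx.
have [_ rys] := index_mem Ik' Cy; apply: meet_eq => //.
exact/(index_segmentP Ik Ik' Cx Cy).
Qed.

(** Unless the meet is the root, the root, x and y lie in three different
    components of its complement. *)
Lemma meet_branch x y : ~ [set x; y] (meet rho x y) ->
  branch_or_root rho (meet rho x y).
Proof.
set m := meet rho x y => mxy; have [rxm rym] := meet_mem tree rho x y.
have [mr|mr] := pselect (m = rho); first by right.
left; split=> //.
apply: (three_components tree rxm rym (meet_segment tree rho x y)).
- exact/nesym.
- by move=> xm; apply: mxy; left.
- by move=> ym; apply: mxy; right.
Qed.

Section CompatibleOrder.
Variable le : T -> T -> Prop.
Hypothesis compat_le : compatible_order rho le.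

Let le_refl x : le x x.
Proof. by have [[h _ _ _] _ _] := compat_le; exact: h. Qed.

Let le_anti x y : le x y -> le y x -> x = y.
Proof. by have [[_ h _ _] _ _] := compat_le; exact: h. Qed.

Let le_trans x y z : le x y -> le y z -> le x z.
Proof. by have [[_ _ h _] _ _] := compat_le; exact: h. Qed.

Let le_total x y : le x y \/ le y x.
Proof. by have [[_ _ _ h] _ _] := compat_le; exact: h. Qed.

(** The only place where the second axiom of compatible orders enters; the
    apex in it is the meet g of x and x', since y branches off at s, below g. *)
Lemma component_convex s k k' x x' y : I s k -> I s k' ->
  C s k x -> C s k x' -> C s k' y -> le x y -> le y x' -> k = k'.
Proof.
move=> Ik Ik' Cx Cx' Cy xy yx'; apply: contrapT => kk'.
have [_ _ or2] := compat_le; move: (or2 _ _ _ xy yx').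
have [_ rxs] := index_mem Ik Cx; have [_ rxs'] := index_mem Ik Cx'.
set g := meet rho x x'; have [rxg _] := meet_mem tree rho x x'.
have rgs : segment rho g s by rewrite (meetP tree).
have sg : segment rho s `<=` segment rho g by move=> z; exact: segment_sub.
rewrite setIUr -!(meetP tree) (index_meet Ik Ik' kk' Cx Cy).
rewrite (setUidr sg) (apexE tree) => ryg.
have rsg : segment rho s g.
  by rewrite -(index_meet Ik Ik' kk' Cx Cy) (meetP tree).
have gs : g = s := segment_anti tree rgs rsg.
have := meet_segment tree rho x x'; rewrite -/g gs.
by move=> /(index_segmentP Ik Ik Cx Cx').
Qed.

(** Moving x to x' and then y to y' without crossing the other component. *)
Lemma component_le s k k' x x' y y' : I s k -> I s k' -> k <> k' ->
  C s k x -> C s k x' -> C s k' y -> C s k' y' -> le x y -> le x' y'.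
Proof.
move=> Ik Ik' kk' Cx Cx' Cy Cy' xy.
have x'y : le x' y.
  by have [//|/(component_convex Ik Ik' Cx Cx' Cy xy)/kk'] := le_total x' y.
have [//|y'x'] := le_total x' y'.
by have /esym/kk' := component_convex Ik' Ik Cy' Cy Cx' y'x' x'y.
Qed.

Definition component_point s k : T := xget rho (C s k).

Definition induced_order s k k' : Prop :=
  le (component_point s k) (component_point s k').

Lemma component_pointP s k : I s k -> C s k (component_point s k).
Proof. by move=> /index_nonempty Cne; exact: (@xgetPex _ rho (C s k)). Qed.

Lemma component_point_inj s k k' : I s k -> I s k' ->
  component_point s k = component_point s k' -> k = k'.
Proof.
move=> Ik Ik' kk'; apply: contrapT.
have Cx := component_pointP Ik; have Cy := component_pointP Ik'.
move=> /(index_segmentP Ik Ik' Cx Cy); rewrite -kk' => /(segmentxx tree).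
by move=> sx; apply: (index_mem_neq Ik Cx).
Qed.

Lemma induced_order_family : order_family rho I induced_order.
Proof.
move=> s _; split=> [k _|k k' Ik Ik'|k1 k2 k3 _ _ _|k k' _ _].
- exact: le_refl.
- by move=> kk' k'k; apply: (component_point_inj Ik Ik'); exact: le_anti.
- exact: le_trans.
- exact: le_total.
Qed.

Lemma induced_orderP s k k' x y : I s k -> I s k' -> k <> k' ->
  C s k x -> C s k' y -> le x y <-> induced_order s k k'.
Proof.
move=> Ik Ik' kk' Cx Cy.
have [Cp Cp'] := (component_pointP Ik, component_pointP Ik').
by split; exact: (component_le Ik Ik' kk').
Qed.

Lemma induced_order_represents : represents rho I C le induced_order.
Proof.
split=> [|x y]; first exact: induced_order_family.
have [rxm rym] := meet_mem tree rho x y.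
split=> [xy|[->|xy _ |k k' _ _ Ik Ik' kk' Cx Cy]].
- have [->|xny] := pselect (x = y); first exact: tree_order_refl.
  have [mxy|mxy] := pselect ([set x; y] (meet rho x y)).
    apply: tree_order_def1 => //; case: mxy => m_eq.
      by rewrite -[X in segment _ _ X]m_eq.
    exfalso; apply: xny; apply: le_anti => //.
    by have [_ or1 _] := compat_le; apply: or1; rewrite -m_eq.
  have [|k Ik Cx] := index_exists _ rxm.
    by move=> xm; apply: mxy; left.
  have [|k' Ik' Cy] := index_exists _ rym.
    by move=> ym; apply: mxy; right.
  have kk' : k <> k'.
    by apply/(index_segmentP Ik Ik' Cx Cy); exact: meet_segment.
  apply: (tree_order_def2 mxy (meet_branch mxy) Ik Ik' kk' Cx Cy).
  exact/(induced_orderP Ik Ik' kk' Cx Cy).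
- exact: le_refl.
- by have [_ or1 _] := compat_le; exact: or1.
- by move=> /(induced_orderP Ik Ik' kk' Cx Cy).
Qed.

End CompatibleOrder.

(** Only the clause for separated points can relate x and y, and the indices it
    provides are k and k' since distinct components are disjoint. *)
Lemma represents_orderP (le : T -> T -> Prop) (O : T -> nat -> nat -> Prop)
    s k k' x y :
  represents rho I C le O -> I s k -> I s k' -> k <> k' ->
  C s k x -> C s k' y -> branch_or_root rho s -> O s k k' <-> le x y.
Proof.
move=> [_ leO] Ik Ik' kk' Cx Cy bs; rewrite leO.
have ms := index_meet Ik Ik' kk' Cx Cy.
have mxy : ~ [set x; y] (meet rho x y).
  by rewrite ms => -[]/esym; [exact: index_mem_neq Cx|exact: index_mem_neq Cy].
split=> [Okk'|[xy|_ /mxy//|j j' _ _]].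
- by apply: (@tree_order_def2 _ _ _ _ _ _ _ _ k k'); rewrite ?ms//; rewrite -ms.
- move/(index_segmentP Ik Ik' Cx Cy): kk'; rewrite xy => /(segmentxx tree).
  by move=> /esym/(index_mem_neq Ik' Cy).
rewrite ms => Ij Ij' jj' Cjx Cjy.
suff [-> ->] : k = j /\ k' = j' by [].
have same i i' z : I s i -> I s i' -> C s i z -> C s i' z -> i = i'.
  move=> Ii Ii' Cz C'z; apply: contrapT => /(index_segmentP Ii Ii' Cz C'z).
  by move=> /(segmentxx tree)/esym; exact: index_mem_neq Cz.
by split; [exact: same Cx Cjx|exact: same Cy Cjy].
Qed.

End CompatibleOrders.

Theorem proposition2p6 (R : realType) (T : metricType R) (rho : T)
    (I : T -> set nat) (C : T -> nat -> set T) (le : T -> T -> Prop)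
    (treeT : @real_tree R T) (compactT : compact [set: T])
    (nontrivT : [set: T] <> [set rho])
    (indexIC : component_indexing rho I C)
    (compat_le : compatible_order rho le) :
  (exists O : T -> nat -> nat -> Prop, represents rho I C le O) /\
  (forall O O' : T -> nat -> nat -> Prop,
     represents rho I C le O -> represents rho I C le O' ->
     forall s, branch_or_root rho s ->
     forall k k', I s k -> I s k' -> (O s k k' <-> O' s k k')).
Proof.
split.
  by exists (induced_order rho C le); exact: induced_order_represents.
move=> O O' repO repO' s bs k k' Ik Ik'.
have [<-|kk'] := pselect (k = k').
  have [[orderO _] [orderO' _]] := (repO, repO').
  have [[Orefl _ _ _] [refl' _ _ _]] := (orderO s bs, orderO' s bs).
  by split=> _; [exact: refl'|exact: Orefl].
have [[x Cx] [y Cy]] := (index_nonempty indexIC Ik, index_nonempty indexIC Ik').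
by rewrite (represents_orderP treeT indexIC repO Ik Ik' kk' Cx Cy bs)
  (represents_orderP treeT indexIC repO' Ik Ik' kk' Cx Cy bs).
Qed.
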